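(* Let $p>3$ be a prime. Then $$\sum_{n=0}^{(p-1)/2}\frac{6n+1}{(-512)^n}\binom{2n}{n}^3\equiv p\left(\frac{-2}{p}\right)+\frac{p^3}{4}\left(\frac{2}{p}\right)E_{p-3}\pmod{p^4}.$$
   Context: $\left(\frac{\cdot}{p}\right)$ denotes the Legendre symbol. The Euler numbers $E_n$ are defined by $\frac{2e^t}{e^{2t}+1}=\sum_{n\ge 0}E_n\frac{t^n}{n!}$ ($|t|<\pi/2$). Congruences between rational numbers whose denominators are coprime to $p$ are understood in the ring of rationals with denominator prime to $p$. *)

(* Defs.v *)
From mathcomp Require Import all_boot all_order all_algebra.
From mathcomp Require Import all_classical all_reals all_analysis.
Import Order.TTheory GRing.Theory Num.Theory numFieldNormedType.Exports.

Set Implicit Arguments.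
Unset Strict Implicit.
Unset Printing Implicit Defensive.

Local Open Scope classical_set_scope.
Local Open Scope ring_scope.

(* The identity determines E, by uniqueness of power series coefficients; the
   numbers it determines are integers, so rational values lose nothing. *)
Definition is_euler_numbers (R : realType) (E : nat -> rat) : Prop :=
  forall t : R, `|t| < pi / 2 ->
    series (fun n => ratr (E n) * (t ^+ n / n`!%:R)) @ \oo
      --> 2 * expR t / (expR (2 * t) + 1).

Definition legendre (a : int) (p : nat) : int :=
  if (p%:Z %| a)%Z then 0
  else if [exists x : 'I_p, (x%:Z ^+ 2 == a %[mod p%:Z])%Z] then 1
  else -1.

(* The ring of rationals with denominator prime to p; denq is the positive
   denominator in lowest terms. *)
Definition prime_to_denom (p : nat) : {pred rat} :=
  [pred x : rat | coprimez (denq x) p%:Z].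

Definition eq_mod_loc (p : nat) (m x y : rat) : Prop :=
  [/\ x \in prime_to_denom p, y \in prime_to_denom p
    & exists2 z, z \in prime_to_denom p & x - y = m * z].

(* Main.v *)
Require Import Defs.
From mathcomp Require Import all_boot all_order all_algebra.
From mathcomp Require Import all_classical all_reals all_analysis.
From mathcomp Require Import finfield.
From mathcomp Require Import ring lra zify.
Import Order.TTheory GRing.Theory Num.Theory numFieldNormedType.Exports.

Local Open Scope ring_scope.

(** Write [N = (p - 1) / 2] and replace [(1/2)_k ^ 3 / k! ^ 3] by
    [(1/2)_k (1/2 + x)_k (1/2 - x)_k / (k! (1 - x/2)_k (1 + x/2)_k)].
    At [x = m + 1/2], [m <= N], the deformed sum stops at [k = m] and equals
    [(-1) ^ (m/2) (2m + 1)] by a WZ recurrence from [m] to [m + 2].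
    Multiplied by the common denominator it is a polynomial of degree at most
    [N] in [x ^ 2], so Lagrange interpolation at these [N + 1] points expresses
    its value at [x = 0], the truncated sum, exactly.  The point [x = p/2]
    contributes [p (-2/p)] modulo [p ^ 4].  Every other term is divisible by
    [p ^ 3], and the quotients add up modulo [p] to an alternating sum of
    [1 / k ^ 2] over [1 <= k <= N], which the Euler polynomial of degree
    [p - 3] evaluates. *)

(** * The terminating hypergeometric sum *)

(* Consecutive quotients of
   [(-1/8)^k (1/2)_k (1+m)_k (-m)_k / (k! (3/4-m/2)_k (5/4+m/2)_k)]. *)
Definition wz_ratio (m i : nat) : rat :=
  - ((2 * i%:R + 1) * (m%:R + 1 + i%:R) * (i%:R - m%:R)) /
    ((i%:R + 1) * (4 * i%:R + 3 - 2 * m%:R) * (4 * i%:R + 5 + 2 * m%:R)).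

Definition wz_coef (m k : nat) : rat := \prod_(i < k) wz_ratio m i.

Lemma odd_even_neq0 (i m : nat) : 4 * i%:R + 3 - 2 * m%:R != 0 :> rat.
Proof.
have -> : 4 * i%:R + 3 - 2 * m%:R = (4 * i + 3)%N%:R - (2 * m)%N%:R :> rat.
  by rewrite natrD !natrM.
rewrite subr_eq0 eqr_nat; lia.
Qed.

Lemma wz_coefS m k : wz_coef m k.+1 = wz_coef m k * wz_ratio m k.
Proof. by rewrite /wz_coef big_ord_recr. Qed.

(** Passing from [m] to [m + 2] moves every Pochhammer parameter by an integer, so all but boundary
    factors cancel and the quotient of the two coefficients is rational in [k]. *)
Lemma wz_coef_shift m k :
  (2 * m%:R + 5) * wz_coef m k =
  - ((2 * m%:R + 1) * (k%:R - m%:R - 1) * (k%:R - m%:R - 2)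
     * (4 * k%:R + 2 * m%:R + 5)) /
    ((m%:R + k%:R + 1) * (m%:R + k%:R + 2) * (4 * k%:R - 2 * m%:R - 1))
  * wz_coef m.+2 k.
Proof.
have Hm : (0 : rat) <= m%:R by exact: ler0n.
have H1 j : 4 * j%:R - 2 * m%:R - 1 != 0 :> rat.
  have := odd_even_neq0 j m.+2; congr (_ != _).
  by rewrite -addn2 natrD; ring.
elim: k => [|k IH].
  rewrite /wz_coef !big_ord0; have := H1 0%N; rewrite mulr0 => H.
  by field; repeat (apply/andP; split); try lra.
have Hk : (0 : rat) <= k%:R by exact: ler0n.
rewrite !wz_coefS mulrA {}IH -mulrA -mulrA /wz_ratio.
have := H1 k; have := H1 k.+1; have := odd_even_neq0 k m.
rewrite -(addn1 k) -(addn2 m) !natrD => a b c.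
have d : 4 * k%:R + 3 - 2 * (m%:R + 2) != 0 :> rat.
  by move: c; congr (_ != _); ring.
field.
rewrite ?a ?b ?c ?d /=; clear -Hm Hk; repeat (apply/andP; split); try lra.
Qed.

Definition wz_sum (m K : nat) : rat :=
  \sum_(k < K) (6 * k%:R + 1) * wz_coef m k.

(** The right-hand side is the WZ certificate: it vanishes at [K = 0], and its increment from [K] to
    [K + 1] is the same combination of the [K]-th summands. *)
Lemma wz_telescope m K :
  (2 * m%:R + 1) * wz_sum m.+2 K + (2 * m%:R + 5) * wz_sum m K =
  - (2 * (2 * m%:R + 1) * (2 * m%:R + 3) * K%:R * (4 * K%:R + 2 * m%:R + 5))
   / ((m%:R + K%:R + 1) * (m%:R + K%:R + 2)) * wz_coef m.+2 K.
Proof.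
have Hm : (0 : rat) <= m%:R by exact: ler0n.
elim: K => [|k IH].
  by rewrite /wz_sum !big_ord0 !mulr0 mul0r oppr0 !mul0r addr0.
have Hk : (0 : rat) <= k%:R by exact: ler0n.
have H1 : 4 * k%:R - 2 * m%:R - 1 != 0 :> rat.
  have := odd_even_neq0 k m.+2; congr (_ != _).
  by rewrite -addn2 natrD; ring.
rewrite /wz_sum !big_ord_recr /= -/(wz_sum m k) -/(wz_sum m.+2 k).
rewrite [X in X = _](_ : _ = ((2 * m%:R + 1) * wz_sum m.+2 k
   + (2 * m%:R + 5) * wz_sum m k)
   + ((2 * m%:R + 1) * ((6 * k%:R + 1) * wz_coef m.+2 k)
   + (6 * k%:R + 1) * ((2 * m%:R + 5) * wz_coef m k))); last by ring.
rewrite {}IH wz_coef_shift wz_coefS /wz_ratio.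
rewrite -(addn1 k) -(addn2 m) !natrD.
have d : 4 * k%:R + 3 - 2 * (m%:R + 2) != 0 :> rat.
  by move: H1; congr (_ != _); ring.
field.
rewrite ?d ?H1 /=; clear -Hm Hk; repeat (apply/andP; split); try lra.
Qed.

Lemma wz_coef_eq0 m k : (m < k)%N -> wz_coef m k = 0.
Proof.
move=> lt_mk; rewrite /wz_coef (bigD1 (Ordinal lt_mk)) //=.
by rewrite /wz_ratio subrr mulr0 oppr0 !mul0r.
Qed.

(** For [K > m + 2] the certificate vanishes with [wz_coef m.+2 K], which leaves
    [(2m + 1) S(m + 2) = - (2m + 5) S(m)]. The cases [m = 0] and [m = 1] are computed directly. *)
Lemma wz_sum_closed m K : (m < K)%N -> wz_sum m K = (-1) ^+ (m %/ 2) * (2 * m%:R + 1).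
Proof.
have [n] := ubnP m; elim: n => // n IH in m K *.
case: m => [|[|m]] lt_mn lt_mK.
- case: K lt_mK => // K _; rewrite /wz_sum big_ord_recl big1 => [|i _].
    by rewrite /wz_coef big_ord0 div0n expr0 /=; ring.
  by rewrite wz_coef_eq0 ?mulr0.
- case: K lt_mK => [|[|K]] // _; rewrite /wz_sum !big_ord_recl big1 => [|i _].
    rewrite /wz_coef !big_ord_recl !big_ord0 /wz_ratio expr0 /=.
    by rewrite /bump /= addn0; field.
  by rewrite wz_coef_eq0 ?mulr0.
have Hm : (0 : rat) <= m%:R by exact: ler0n.
have := wz_telescope m K; rewrite wz_coef_eq0 // mulr0 (IH m K); try lia.
have -> : (m.+2 %/ 2 = (m %/ 2).+1)%N by lia.
rewrite exprS -(addn2 m) natrD => H.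
have H0 : 2 * m%:R + 1 != 0 :> rat by lra.
apply: (mulfI H0); move: H; set s := (-1) ^+ _; lra.
Qed.

(** The interpolant [L] also has size at most [N], and [W - L] vanishes at [N] distinct points. *)
Lemma lagrange_eval (F : fieldType) (N : nat) (x : 'I_N -> F) (W : {poly F}) z :
  injective x -> (size W <= N)%N ->
  W.[z] = \sum_m W.[x m] * \prod_(l | l != m) ((z - x l) / (x m - x l)).
Proof.
move=> x_inj sW.
pose L := \sum_m (W.[x m] *: \prod_(l | l != m)
                  ((x m - x l)^-1 *: ('X - (x l)%:P))).
have LE t : L.[t] = \sum_m W.[x m] * \prod_(l | l != m) ((t - x l) / (x m - x l)).
  rewrite horner_sum; apply: eq_bigr => m _; rewrite hornerZ horner_prod.
  congr (_ * _); apply: eq_bigr => l _.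
  by rewrite hornerZ !hornerE mulrC.
rewrite -LE; suff -> : W = L by [].
have sL : (size L <= N)%N.
  apply: (leq_trans (size_sum _ _ _)); apply/bigmax_leqP => m _.
  apply: (leq_trans (size_scale_leq _ _)).
  apply: (leq_trans (size_prod_leq _ _)).
  have cE : #|(fun l : 'I_N => l != m)| = N.-1.
    by rewrite -[in RHS](card_ord N) -(cardC1 m); apply: eq_card.
  have : (\sum_(l | l != m) size ((x m - x l)^-1 *: ('X - (x l)%:P)) <=
          \sum_(l : 'I_N | l != m) 2)%N.
    apply: leq_sum => l _; apply: (leq_trans (size_scale_leq _ _)).
    by rewrite size_XsubC.
  rewrite sum_nat_const /= cE; set t := (\sum_(_ < _ | _) _)%N.
  have := ltn_ord m; lia.
apply/eqP; rewrite -subr_eq0; apply/eqP.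
apply: (@roots_geq_poly_eq0 _ _ [seq x m | m : 'I_N]).
- apply/allP => _ /fintype.imageP[m _ ->]; rewrite /root hornerD hornerN LE.
  rewrite (bigD1 m) //= big1 ?mulr1 => [|l lm]; last first.
    by rewrite divff // subr_eq0; apply: contra lm => /eqP/x_inj ->.
  rewrite big1 ?addr0 ?subrr // => l lm.
  by rewrite (bigD1 m) /= 1?eq_sym // subrr mul0r mul0r mulr0.
- by rewrite map_inj_uniq ?enum_uniq.
- rewrite size_image card_ord; apply: (leq_trans (size_polyD _ _)).
  by rewrite size_polyN geq_max sW.
Qed.

(** * Expansion of the truncated sum by interpolation *)

(* Here [X = (2x)^2]: [X = 0] gives the sum of the theorem and
   [X = (2m+1)^2] the terminating sums. *)
Definition trunc_ratio (X : rat) (i : nat) : rat :=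
  - ((2 * i%:R + 1) * ((2 * i%:R + 1) ^+ 2 - X)) /
    (4 * i.+1%:R * (16 * i.+1%:R ^+ 2 - X)).

Lemma size_prod_linear_leq (F : fieldType) (c : nat -> F) (r : seq nat) :
  (size (\prod_(i <- r) ((c i)%:P - 'X))%R <= (size r).+1)%N.
Proof.
elim: r => [|i r IH]; first by rewrite big_nil size_poly1.
rewrite big_cons /=; apply: (leq_trans (size_polyMleq _ _)).
apply: (@leq_trans (2 + (size r).+1).-1) => //.
by rewrite -!subn1 leq_sub2r // leq_add // -size_polyN opprB size_XsubC.
Qed.

(** Both differences of squares split; the one in the numerator is [4 (i - m) (i + m + 1)]. *)
Lemma trunc_ratio_odd_square (m i : nat) :
  trunc_ratio ((2 * m%:R + 1) ^+ 2) i = wz_ratio m i.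
Proof.
have Hi : (0 : rat) <= i%:R by exact: ler0n.
have Hm : (0 : rat) <= m%:R by exact: ler0n.
rewrite /trunc_ratio /wz_ratio -(addn1 i) natrD.
have H := odd_even_neq0 i m.
have E : 16 * (i%:R + 1) ^+ 2 - (2 * m%:R + 1) ^+ 2 =
  (4 * i%:R + 3 - 2 * m%:R) * (4 * i%:R + 5 + 2 * m%:R) :> rat by ring.
have H2 : 4 * i%:R + 5 + 2 * m%:R != 0 :> rat by lra.
have H3 : 16 * (i%:R + 1) ^+ 2 - (2 * m%:R + 1) ^+ 2 != 0 :> rat.
  by rewrite E mulf_neq0.
by field; rewrite H H2 H3 /= andbT; lra.
Qed.

Definition trunc_sum (N : nat) (X : rat) : rat :=
  \sum_(k < N.+1) (6 * k%:R + 1) * \prod_(i < k) trunc_ratio X i.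

(** Multiplication by the product of all [16 (i + 1)^2 - X] turns the [k]-th summand into a
    polynomial in [X] with [k] linear factors from its numerator and [N - k] from the uncancelled
    denominators. The degree is at most [N], so [N + 1] nodes suffice. *)
Lemma trunc_sum_lagrange (N : nat) (X : rat) (x : 'I_N.+1 -> rat) :
  injective x ->
  (forall i, (i < N)%N -> 16 * i.+1%:R ^+ 2 - X != 0) ->
  (forall m i, (i < N)%N -> 16 * i.+1%:R ^+ 2 - x m != 0) ->
  trunc_sum N X =
  \sum_m trunc_sum N (x m)
    * \prod_(i < N) ((16 * i.+1%:R ^+ 2 - x m) / (16 * i.+1%:R ^+ 2 - X))
    * \prod_(l | l != m) ((X - x l) / (x m - x l)).
Proof.
move=> x_inj nzX nzx.
(* With these, [trunc_ratio t i = u i (c i - t) / (d i - t)]. *)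
pose c i : rat := (2 * i%:R + 1) ^+ 2.
pose d i : rat := 16 * i.+1%:R ^+ 2.
pose u i : rat := - (2 * i%:R + 1) / (4 * i.+1%:R).
pose W := \sum_(k < N.+1) ((6 * k%:R + 1) * \prod_(0 <= i < k) u i) *:
  (\prod_(i <- index_iota 0 k) ((c i)%:P - 'X)
   * \prod_(i <- index_iota k N) ((d i)%:P - 'X)).
have sW : (size W <= N.+1)%N.
  apply: (leq_trans (size_sum _ _ _)); apply/bigmax_leqP => k _.
  apply: (leq_trans (size_scale_leq _ _)).
  apply: (leq_trans (size_polyMleq _ _)).
  apply: (@leq_trans (k.+1 + (N - k).+1).-1); last by have := ltn_ord k; lia.
  have := size_prod_linear_leq _ c (index_iota 0 k).
  have := size_prod_linear_leq _ d (index_iota k N).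
  by rewrite !size_iota subn0 -!subn1 => sd sc; rewrite leq_sub2r // leq_add.
have WE t : (forall i, (i < N)%N -> d i - t != 0) ->
    W.[t] = trunc_sum N t * \prod_(0 <= i < N) (d i - t).
  move=> nzt; rewrite horner_sum mulr_suml; apply: eq_bigr => k _.
  have kN : (k <= N)%N by rewrite -ltnS ltn_ord.
  rewrite hornerZ hornerM !horner_prod -!mulrA; congr (_ * _).
  rewrite (big_cat_nat (m := 0) (n := k) (p := N)) //= [RHS]mulrA [LHS]mulrA; congr (_ * _); last first.
    by apply: eq_bigr => i _; rewrite !hornerE.
  rewrite -(big_mkord xpredT (trunc_ratio t)) -!big_split /= !big_nat.
  apply: eq_bigr => i /andP[_ ik].
  have := nzt i (leq_trans ik kN) => nz.
  rewrite hornerD hornerN hornerC hornerX /u /trunc_ratio -/(c i) -/(d i); field.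
  by rewrite nz /= addrC natr1 pnatr_eq0.
have DX : \prod_(0 <= i < N) (d i - X) != 0.
  by rewrite big_mkord; apply/prodf_neq0 => i _; apply: nzX.
apply: (mulIf DX); rewrite -(WE _ nzX) (lagrange_eval _ _ x W X x_inj sW) mulr_suml.
apply: eq_bigr => m _; rewrite (WE _ (nzx m)).
rewrite -!mulrA; congr (_ * _); rewrite [RHS]mulrCA [LHS]mulrC; congr (_ * _).
rewrite !big_mkord -big_split /=; apply: eq_bigr => i _.
by rewrite (divfK (nzX _ (ltn_ord i))).
Qed.

(** At [X = 0] the ratio is [- (2i + 1)^3 / (64 (i + 1)^3)], which is [-1/512] times the cube of the
    quotient [2 (2i + 1) / (i + 1)] of consecutive central binomials. *)
Lemma trunc_sum0 N :
  trunc_sum N 0 = \sum_(0 <= n < N.+1)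
    (6 * n + 1)%:R / (- 512) ^+ n * 'C(2 * n, n)%:R ^+ 3.
Proof.
rewrite big_mkord; apply: eq_bigr => k _.
rewrite natrD natrM -mulrA; congr (_ * _).
elim: (val k) => [|n IH]; first by rewrite big_ord0 expr0 bin0; field.
rewrite big_ord_recr /= IH /trunc_ratio.
have HC : 'C(2 * n.+1, n.+1)%:R = 2 * (2 * n%:R + 1) / n.+1%:R * 'C(2 * n, n)%:R :> rat.
  have n0 : n.+1%:R != 0 :> rat by rewrite pnatr_eq0.
  apply: (mulfI n0).
  rewrite [RHS](_ : _ = 2 * ((2 * n%:R + 1) * 'C(2 * n, n)%:R)); last first.
    by field; rewrite addrC natr1.
  have e1 : (n.+1 * 'C(2 * n.+1, n.+1) = 2 * (n.+1 * 'C((2 * n).+1, n)))%N.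
    have -> : (2 * n.+1 = (2 * n).+1.+1)%N by lia.
    by rewrite -mul_bin_diag /= mulnA; congr (_ * _)%N; lia.
  have e2 : (n.+1 * 'C((2 * n).+1, n) = (2 * n).+1 * 'C(2 * n, n))%N.
    have := mul_bin_down (2 * n).+1 n; rewrite /= => ->.
    by congr (_ * _)%N; lia.
  by rewrite -[LHS]natrM e1 e2 !natrM -(addn1 (2 * n)) natrD natrM.
rewrite HC -(addn1 n) natrD exprD expr1.
have Hn : (0 : rat) <= n%:R by exact: ler0n.
have H5 : (- 512) ^+ n != 0 :> rat by apply: expf_neq0; lra.
field; rewrite H5 /=; lra.
Qed.

(** The nodes are the odd squares up to [(2N + 1)^2], where [wz_sum_closed] evaluates the sum; for
    [p = 2N + 1] the last node is [p^2]. *)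
Lemma truncated_sum_expansion N :
  \sum_(0 <= n < N.+1) (6 * n + 1)%:R / (- 512) ^+ n * 'C(2 * n, n)%:R ^+ 3 =
  \sum_(m < N.+1) (-1) ^+ (m %/ 2) * (2 * m + 1)%:R
    * \prod_(i < N) ((16 * i.+1%:R ^+ 2 - (2 * m + 1)%:R ^+ 2) / (16 * i.+1%:R ^+ 2))
    * \prod_(l < N.+1 | l != m)
        ((2 * l + 1)%:R ^+ 2 / ((2 * l + 1)%:R ^+ 2 - (2 * m + 1)%:R ^+ 2)) :> rat.
Proof.
rewrite -trunc_sum0.
have oddE (m : nat) : (2 * m + 1)%:R = 2 * m%:R + 1 :> rat by rewrite natrD natrM.
pose x (m : 'I_N.+1) : rat := (2 * m + 1)%:R ^+ 2.
rewrite (@trunc_sum_lagrange N 0 x).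
- apply: eq_bigr => m _; congr (_ * _ * _).
  + rewrite /x /trunc_sum !oddE.
    have := wz_sum_closed m N.+1 (ltn_ord m); rewrite /wz_sum => <-.
    apply: eq_bigr => k _; congr (_ * _); apply: eq_bigr => i _.
    exact: trunc_ratio_odd_square.
  + by apply: eq_bigr => i _; rewrite subr0.
  + apply: eq_bigr => l _; rewrite /x sub0r -[X in _ = _ / X]opprB.
    by rewrite invrN mulrN mulNr.
- move=> m l /eqP; rewrite /x eqrXn2 ?ler0n // eqr_nat => /eqP H.
  by apply/val_inj => /=; lia.
- by move=> i _; rewrite subr0 mulf_neq0 // expf_neq0 // pnatr_eq0.
(* An even square is never an odd square. *)
- move=> m i _; rewrite /x subr_eq0 -!natrX -natrM eqr_nat.
  by apply/eqP => /(congr1 odd); rewrite !(oddM, oddX, oddD) /=.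
Qed.

(** * Euler numbers and power series *)

Lemma sum_exp_le2 (R : realFieldType) (x : R) n :
  0 <= x -> x <= 1 / 2 -> \sum_(i < n) x ^+ i <= 2.
Proof.
move=> x0 x1; elim: n => [|n IH]; first by rewrite big_ord0.
rewrite big_ord_recl expr0.
under eq_bigr do rewrite exprS.
rewrite -mulr_sumr; nra.
Qed.

(** Convergence at [r] bounds all [|a k| r^k] by one [M]. For [|t| <= r / 2] the tail is then
    dominated by a geometric series of ratio [|t| / r <= 1/2], with sum at most
    [2 M (|t| / r)^n]. *)
Lemma pseries_remainder (R : realType) (a : nat -> R) (f : R -> R) (r : R) n :
  0 < r ->
  (forall t, `|t| <= r ->
    (series (fun k => a k * t ^+ k) @ \oo --> f t)%classic) ->
  exists C, forall t, `|t| <= r / 2 ->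
    `|f t - \sum_(k < n) a k * t ^+ k| <= C * `|t| ^+ n.
Proof.
move=> r0 cvf.
have /cvg_series_bounded : cvgn (series (fun k => a k * r ^+ k)).
  by apply/cvg_ex; exists (f r); apply: cvf; rewrite ger0_norm // ltW.
move=> [M0 [_ /(_ (M0 + 1))]].
rewrite ltrDl ltr01 => /(_ isT); set M := M0 + 1 => Mb.
exists (2 * M / r ^+ n) => t tr.
have xE : `|t| = `|t| / r * r by rewrite divfK // gt_eqF.
set x := `|t| / r in xE.
have x0 : 0 <= x by rewrite divr_ge0 // ltW.
have x1 : x <= 1 / 2.
  by rewrite /x ler_pdivrMr //; move: tr; lra.
have ab k : `|a k * t ^+ k| <= M * x ^+ k.
  have := Mb k I; rewrite /= !normrM !normrX (ger0_norm (ltW r0)) xE exprMn.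
  move=> H; rewrite mulrCA mulrC ler_wpM2r // exprn_ge0 //.
have M_ge0 : 0 <= M by apply: le_trans (Mb 0%N I).
have -> : 2 * M / r ^+ n * `|t| ^+ n = M * x ^+ n * 2.
  rewrite xE exprMn; field.
  by rewrite expf_neq0 // gt_eqF.
have cv : ((fun m => `|series (fun k => a k * t ^+ k) m - \sum_(k < n) a k * t ^+ k|)
   @ \oo --> `|f t - \sum_(k < n) a k * t ^+ k|)%classic.
  apply: cvg_norm; apply: cvgB; last exact: cvg_cst.
  by apply: cvf; move: tr; lra.
apply: (cvgr_to_le cv); near=> m.
have nm : (n <= m)%N by near: m; exact: nbhs_infty_ge.
have -> : \sum_(k < n) a k * t ^+ k = series (fun k => a k * t ^+ k) n.
  by rewrite seriesEord.
rewrite sub_series_geq //; apply: (le_trans (ler_norm_sum _ _ _)).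
apply: (@le_trans _ _ (\sum_(n <= k < m) M * x ^+ k)); first exact: ler_sum.
rewrite -mulr_sumr -mulrA ler_wpM2l //.
rewrite -{1}[n]add0n big_addn big_mkord.
under eq_bigr do rewrite exprD mulrC.
by rewrite -mulr_sumr ler_wpM2l ?exprn_ge0 // sum_exp_le2.
Unshelve. all: by end_near. Qed.

Lemma norm_horner_le (R : realFieldType) (P : {poly R}) t :
  `|t| <= 1 -> `|P.[t]| <= \sum_(i < size P) `|P`_i|.
Proof.
move=> t1; rewrite horner_coef; apply: (le_trans (ler_norm_sum _ _ _)).
apply: ler_sum => i _; rewrite normrM normrX ler_piMr //.
by rewrite exprn_ile1.
Qed.

(** The constant term is [O(t)], hence zero; dividing by [X] lowers [n] by one. *)
Lemma coef_eq0_of_small (R : realFieldType) (P : {poly R}) (C r : R) n :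
  0 < r -> r <= 1 -> (forall t, 0 < t -> t <= r -> `|P.[t]| <= C * t ^+ n) ->
  forall k, (k < n)%N -> P`_k = 0.
Proof.
move=> r0 r1; elim: n => [//|n IH] in P *.
move=> bP.
have [S PE] : exists S, P = S * 'X + (P`_0)%:P.
  exists (\poly_(i < (size P).-1) P`_i.+1).
  apply/polyP => -[|i]; rewrite coefD coefMX coefC /= ?add0r ?addr0 //.
  rewrite coef_poly; case: ltnP => // sP; rewrite nth_default //; lia.
have P0 : P`_0 = 0.
  apply/eqP; rewrite -normr_le0 leNgt; apply/negP => P0.
  pose B := `|C| + \sum_(i < size S) `|S`_i| + 1.
  have B0 : 0 < B.
    rewrite ltr_wpDl // addr_ge0 // sumr_ge0 //.
  have bnd t : 0 < t -> t <= r -> `|P`_0| <= B * t.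
    move=> t0 tr; have := bP t t0 tr.
    have t1 : `|t| <= 1 by rewrite gtr0_norm // (le_trans tr).
    have := norm_horner_le _ S t t1.
    have -> : P.[t] = S.[t] * t + P`_0 by rewrite {1}PE !hornerE.
    move=> bS bt.
    have -> : P`_0 = (S.[t] * t + P`_0) - S.[t] * t by ring.
    apply: (le_trans (ler_normB _ _)); rewrite normrM (gtr0_norm t0).
    have : C * t ^+ n.+1 <= `|C| * t.
      apply: (@le_trans _ _ (`|C| * t ^+ n.+1)).
        by rewrite ler_wpM2r ?ler_norm // exprn_ge0 // ltW.
      have tn : t ^+ n <= 1 by rewrite exprn_ile1 ?(le_trans tr) // ltW.
      by rewrite ler_wpM2l // exprS ler_piMr // ltW.
    rewrite /B; move: bS bt; nra.
  (* At a [t] no larger than this value, [bnd] would give [|P_0| <= |P_0| / 2]. *)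
  have q0 : 0 < `|P`_0| / (2 * B) by rewrite divr_gt0 // mulr_gt0.
  have [q qpos [qr qB]] : exists2 q, 0 < q & q <= r /\ q <= `|P`_0| / (2 * B).
    have [rq|qr] := lerP r (`|P`_0| / (2 * B)); first by exists r.
    by exists (`|P`_0| / (2 * B)); rewrite // ltW.
  have := bnd q qpos qr.
  have : B * q <= B * (`|P`_0| / (2 * B)) by rewrite ler_wpM2l // ltW.
  have -> : B * (`|P`_0| / (2 * B)) = `|P`_0| / 2 by field; rewrite gt_eqF.
  by move: P0; lra.
case=> [//|k]; rewrite ltnS => kn.
rewrite {1}PE P0 coefD coefMX coefC /= addr0; apply: IH kn => t t0 tr.
have := bP t t0 tr; rewrite {1}PE P0 !hornerE normrM (gtr0_norm t0) exprSr mulrA.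
by rewrite ler_pM2r.
Qed.

(* Comparing Taylor polynomials up to [O(t^n)] replaces a Cauchy product. *)
Lemma pseries_mul_const (R : realType) (a b : nat -> R) (f g : R -> R) (r c : R) :
  0 < r ->
  (forall t, `|t| <= r ->
    (series (fun k => a k * t ^+ k) @ \oo --> f t)%classic) ->
  (forall t, `|t| <= r ->
    (series (fun k => b k * t ^+ k) @ \oo --> g t)%classic) ->
  (forall t, `|t| <= r -> f t * g t = c) ->
  forall n, \sum_(i < n.+1) a i * b (n - i)%N = c *+ (n == 0%N).
Proof.
move=> r0 cf cg fg n.
have [Cf Hf] := pseries_remainder _ _ _ _ n.+1 r0 cf.
have [Cg Hg] := pseries_remainder _ _ _ _ n.+1 r0 cg.
pose A := \poly_(k < n.+1) a k; pose B := \poly_(k < n.+1) b k.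
pose s (P : {poly R}) := \sum_(i < size P) `|P`_i|.
have s0 P : 0 <= s P by exact: sumr_ge0.
have /(_ n (ltnSn n)) : forall k, (k < n.+1)%N -> (A * B - c%:P)`_k = 0.
  (* The constant bounds [(f - A) B + (A + (f - A)) (g - B)], which is [f g - A B]; the radius lies
     below both [1] and [r / 2]. *)
  apply: (@coef_eq0_of_small _ _ (`|Cf| * s B + (s A + `|Cf|) * `|Cg|)
           (r / (2 * (1 + r)))).
  - by rewrite divr_gt0 // mulr_gt0 // addr_gt0.
  - by rewrite ler_pdivrMr; move: r0; lra.
  move=> t t0 tr'.
  have [t1 tr] : t <= 1 /\ t <= r / 2.
    split; apply: (le_trans tr'); rewrite ler_pdivrMr; move: r0; nra.
  have nt : `|t| = t by rewrite gtr0_norm.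
  have := Hf t; have := Hg t; rewrite nt => /(_ tr) hg /(_ tr) hf.
  have := norm_horner_le _ A t; rewrite nt => /(_ t1); rewrite -/(s A) => hA.
  have := norm_horner_le _ B t; rewrite nt => /(_ t1); rewrite -/(s B) => hB.
  have AE : \sum_(k < n.+1) a k * t ^+ k = A.[t] by rewrite horner_poly.
  have BE : \sum_(k < n.+1) b k * t ^+ k = B.[t] by rewrite horner_poly.
  rewrite AE in hf; rewrite BE in hg.
  have T0 : 0 <= t ^+ n.+1 by rewrite exprn_ge0 // ltW.
  have T1 : t ^+ n.+1 <= 1 by rewrite exprn_ile1 // ltW.
  move: hf hg T0 T1; set T := t ^+ n.+1 => hf hg T0 T1.
  rewrite !hornerE -(fg t) ?nt; last by move: tr; lra.
  have -> : A.[t] * B.[t] - f t * g t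
     = - ((f t - A.[t]) * B.[t]) - (A.[t] + (f t - A.[t])) * (g t - B.[t]).
    by ring.
  have hf' : `|f t - A.[t]| <= `|Cf| * T.
    by apply: (le_trans hf); rewrite ler_wpM2r // ler_norm.
  have hg' : `|g t - B.[t]| <= `|Cg| * T.
    by apply: (le_trans hg); rewrite ler_wpM2r // ler_norm.
  apply: (le_trans (ler_normB _ _)); rewrite normrN !normrM mulrDl lerD //.
    by rewrite mulrAC ler_pM.
  rewrite -mulrA ler_pM // (le_trans (ler_normD _ _)) // lerD //.
  by apply: (le_trans hf'); rewrite ler_piMr.
rewrite coefB coefM coefC => /eqP; rewrite subr_eq0 => /eqP.
have -> : (if n == 0%N then c else 0) = c *+ (n == 0%N) by case: eqP.
move=> <-; apply: eq_bigr => i _; rewrite !coef_poly ltn_ord ltnS leq_subr //.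
Qed.

(** The generating function times [exp t + exp (- t)] is the constant 2. Comparing coefficients of
    [t^n] and multiplying by [n!] gives an identity in [R], which descends to [rat] by injectivity
    of [ratr]. *)
Lemma euler_numbers_recurrence (R : realType) (E : nat -> rat) :
  is_euler_numbers R E ->
  forall n, \sum_(k < n.+1) 'C(n, k)%:R * E k * (1 + (-1) ^+ (n - k)) =
            2 *+ (n == 0%N).
Proof.
move=> hE n.
have exp_cvg (s t : R) : (series (fun k => s ^+ k / k`!%:R * t ^+ k) @ \oo
                 --> expR (s * t))%classic.
  have -> : (fun k => s ^+ k / k`!%:R * t ^+ k) = exp_coeff (s * t).
    by apply/funext => k; rewrite /exp_coeff /= exprMn mulrAC.
  exact: is_cvg_series_exp_coeff.
have H : \sum_(i < n.+1) (ratr (E i) / i`!%:R) *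
           ((1 + (-1) ^+ (n - i)) / (n - i)`!%:R) = 2 *+ (n == 0%N) :> R.
  apply: (@pseries_mul_const R (fun k => ratr (E k) / k`!%:R)
    (fun k => (1 + (-1) ^+ k) / k`!%:R)
    (fun t => 2 * expR t / (expR (2 * t) + 1))
    (fun t => expR t + expR (- t)) (1 / 2)); first by lra.
  - move=> t t1; under eq_fun do rewrite mulrAC -mulrA.
    apply: hE; apply: (le_lt_trans t1).
    by have := pihalf_ge1 R; lra.
  - move=> t t1.
    have cu := cvgD (exp_cvg 1 t) (exp_cvg (-1) t).
    rewrite mul1r mulN1r in cu.
    suff -> : series (fun k => (1 + (-1) ^+ k) / k`!%:R * t ^+ k) =
      (series (fun k => 1 ^+ k / k`!%:R * t ^+ k)
       \+ series (fun k => (-1) ^+ k / k`!%:R * t ^+ k)) by exact: cu.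
    apply/funext => m.
    rewrite /series /= -big_split /=; apply: eq_bigr => k _.
    by rewrite expr1n -!mulrDl.
  - move=> t t1; have -> : 2 * t = t + t by ring.
    rewrite expRN expRD.
    have := expR_gt0 t => e0; field.
    by rewrite !gt_eqF // addr_gt0 // mulr_gt0.
apply: (fmorph_inj (ratr : {rmorphism rat -> R})).
rewrite rmorph_sum /=.
have -> : ratr (2 *+ (n == 0%N)) = 2 *+ (n == 0%N) :> R.
  by case: eqP => _; rewrite ?mulr1n ?mulr0n ?rmorph0 ?(ratr_nat R 2).
have nf : n`!%:R != 0 :> R by rewrite pnatr_eq0 -lt0n fact_gt0.
have -> : 2 *+ (n == 0%N) = n`!%:R * (2 *+ (n == 0%N)) :> R.
  by case: eqP => [->|_]; rewrite ?fact0 ?mul1r // mulr0n mulr0.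
rewrite -H mulr_sumr; apply: eq_bigr => k _.
have kn : (k <= n)%N by rewrite -ltnS ltn_ord.
rewrite -(bin_fact kn) !natrM !rmorphM rmorphD rmorphXn rmorphN rmorph1 rmorph_nat /=.
have f1 : k`!%:R != 0 :> R by rewrite pnatr_eq0 -lt0n fact_gt0.
have f2 : (n - k)`!%:R != 0 :> R by rewrite pnatr_eq0 -lt0n fact_gt0.
by field; rewrite f1 f2.
Qed.

(** * Reduction modulo p *)

(* The reduction map from the localization of Z at p to F_p, as a relation. *)
Definition reduces (p : nat) (x : rat) (r : 'F_p) : Prop :=
  exists a b : int,
    [/\ b%:~R != 0 :> 'F_p, x = a%:~R / b%:~R & r = a%:~R / b%:~R].

Lemma reduces_int p (a : int) : reduces p a%:~R a%:~R.
Proof. by exists a, 1; rewrite oner_neq0 !divr1. Qed.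

Lemma reduces_nat p (a : nat) : reduces p a%:R a%:R.
Proof. exact: (reduces_int p a). Qed.

Lemma intr_Fp_rat p (b : int) : b%:~R != 0 :> 'F_p -> b%:~R != 0 :> rat.
Proof. by apply: contra; rewrite intr_eq0 => /eqP ->. Qed.

Lemma reducesD p x y r s :
  reduces p x r -> reduces p y s -> reduces p (x + y) (r + s).
Proof.
move=> [a [b [b0 -> ->]]] [c [d [d0 -> ->]]].
have b1 := intr_Fp_rat _ _ b0; have d1 := intr_Fp_rat _ _ d0.
exists (a * d + c * b), (b * d).
by rewrite !rmorphM !rmorphD !rmorphM mulf_neq0 // -!addf_div.
Qed.

Lemma reducesM p x y r s :
  reduces p x r -> reduces p y s -> reduces p (x * y) (r * s).
Proof.
move=> [a [b [b0 -> ->]]] [c [d [d0 -> ->]]].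
exists (a * c), (b * d); rewrite !rmorphM mulf_neq0 //.
by split=> //; rewrite mulf_div.
Qed.

Lemma reducesN p x r : reduces p x r -> reduces p (- x) (- r).
Proof.
by move=> [a [b [b0 -> ->]]]; exists (- a), b; rewrite !rmorphN !mulNr.
Qed.

Lemma reducesB p x y r s :
  reduces p x r -> reduces p y s -> reduces p (x - y) (r - s).
Proof. by move=> hx hy; apply: reducesD => //; apply: reducesN. Qed.

Lemma reducesV p x r : r != 0 -> reduces p x r -> reduces p x^-1 r^-1.
Proof.
move=> r0 [a [b [b0 -> rE]]]; rewrite rE in r0 *.
exists b, a; rewrite !invf_div; split=> //.
by apply: contra r0 => /eqP ->; rewrite mul0r.
Qed.

Lemma reducesX p x r n : reduces p x r -> reduces p (x ^+ n) (r ^+ n).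
Proof.
move=> hx; elim: n => [|n IH]; first exact: (reduces_nat p 1).
by rewrite !exprS; apply: reducesM.
Qed.

Lemma reduces_sum p (I : Type) (s : seq I) (P : pred I) (x : I -> rat) r :
  (forall i, P i -> reduces p (x i) (r i)) ->
  reduces p (\sum_(i <- s | P i) x i) (\sum_(i <- s | P i) r i).
Proof.
move=> h; apply: (big_ind2 (reduces p)) => //; first exact: (reduces_nat p 0).
by move=> *; apply: reducesD.
Qed.

Lemma reduces_prod p (I : Type) (s : seq I) (P : pred I) (x : I -> rat) r :
  (forall i, P i -> reduces p (x i) (r i)) ->
  reduces p (\prod_(i <- s | P i) x i) (\prod_(i <- s | P i) r i).
Proof.
move=> h; apply: (big_ind2 (reduces p)) => //; first exact: (reduces_nat p 1).
by move=> *; apply: reducesM.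
Qed.

Lemma natr_Fp_eq0 p n : prime p -> (n%:R == 0 :> 'F_p) = (p %| n)%N.
Proof. by move=> pr; rewrite (dvdn_pcharf (pchar_Fp pr)). Qed.

Lemma natr_Fp_neq0 p n : prime p -> (0 < n < p)%N -> n%:R != 0 :> 'F_p.
Proof.
by move=> pr /andP[n0 np]; rewrite natr_Fp_eq0 //; apply/negP => /dvdn_leq; lia.
Qed.

Lemma intr_Fp_eq0 p (n : int) : prime p -> (n%:~R == 0 :> 'F_p) = (p %| n)%Z.
Proof. by move=> pr; rewrite (dvdz_pcharf (pchar_Fp pr)). Qed.

(** If [x = a / b], the reduced denominator divides [b], which is prime to [p]. *)
Lemma reduces_prime_to_denom p x r :
  prime p -> reduces p x r -> x \in prime_to_denom p.
Proof.
move=> pr [a [b [b0 xE _]]]; rewrite inE /coprimez.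
have b1 := intr_Fp_rat _ _ b0.
have H : numq x * b = a * denq x.
  apply: (@intr_inj rat); rewrite !rmorphM /=.
  rewrite -[x]divq_num_den in xE; move/eqP: xE.
  by rewrite eqr_div ?intr_eq0 ?denq_neq0 -?(intr_eq0 rat) // => /eqP.
have dvd : (denq x %| b)%Z.
  by rewrite -(Gauss_dvdzr _ (m := denq x) (n := numq x)) ?H ?dvdz_mull //
    coprimez_sym; exact: coprime_num_den.
have ndvd : ~~ (p %| `|denq x|)%N.
  apply: contra b0 => pd; rewrite intr_Fp_eq0 //.
  exact: (dvdz_trans _ dvd).
by have := ndvd; rewrite -prime_coprime // coprime_sym.
Qed.

(** Extracts one factor [p]: a zero residue means that [p] divides the numerator. *)
Lemma reduces0 p x :
  prime p -> reduces p x 0 -> exists y s, reduces p y s /\ x = p%:R * y.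
Proof.
move=> pr [a [b [b0 -> /esym/eqP]]].
rewrite mulf_eq0 invr_eq0 (negPf b0) orbF intr_Fp_eq0 // => /dvdzP[c ->].
exists (c%:~R / b%:~R), (c%:~R / b%:~R); split; first by exists c, b.
by rewrite rmorphM /= -mulrA mulrCA.
Qed.

(** * Fermat's theorem and the squares modulo p *)

Lemma Fp_expf_pred p (x : 'F_p) : prime p -> x != 0 -> x ^+ p.-1 = 1.
Proof.
move=> pr x0; apply: (mulfI x0); rewrite -exprS prednK ?prime_gt0 // mulr1.
by have := expf_card x; rewrite card_Fp.
Qed.

(** In the factored difference of squares, the sum lies strictly between 0 and [p] and the
    difference is below [p] in absolute value. *)
Lemma sqr_natr_Fp_inj p N (k l : 'I_N) : prime p -> p = (2 * N + 1)%N ->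
  k.+1%:R ^+ 2 = l.+1%:R ^+ 2 :> 'F_p -> k = l.
Proof.
move=> pr pE; wlog lt_kl : k l / (k <= l)%N => [IH|/esym/eqP].
  by case/orP: (leq_total k l) => [/IH//|/IH H /esym/H].
rewrite -subr_eq0 subr_sqr -natrB // -natrD mulf_eq0 !natr_Fp_eq0 //.
have := ltn_ord k; have := ltn_ord l => lN kN /orP[] /dvdnP[q qE].
  apply: val_inj => /=; case: q qE => [|q]; nia.
case: q qE => [|q]; nia.
Qed.

(** By Fermat the squares are roots of [X^N - 1], and these [N] roots are distinct. *)
Lemma prod_XsubC_squares p N : prime p -> p = (2 * N + 1)%N ->
  \prod_(k < N) ('X - (k.+1%:R ^+ 2)%:P) = 'X^N - 1 :> {poly 'F_p}.
Proof.
move=> pr pE.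
have N0 : (0 < N)%N by have := prime_gt1 pr; lia.
pose rs := [seq (k.+1%:R ^+ 2 : 'F_p) | k : 'I_N].
have := @all_roots_prod_XsubC 'F_p ('X^N - 1%:P) rs.
rewrite /rs big_image /= size_image card_ord size_XnsubC // lead_coefXnsubC //.
rewrite scale1r => -> //.
- apply/allP => _ /fintype.imageP[k _ ->]; rewrite rootE !hornerE subr_eq0.
  rewrite -exprM (_ : (2 * N)%N = p.-1); last by rewrite pE addn1.
  rewrite Fp_expf_pred // natr_Fp_eq0 //; apply/negP => /dvdn_leq.
  by have := ltn_ord k; lia.
- rewrite uniq_rootsE map_inj_uniq ?enum_uniq // => k l.
  exact: (sqr_natr_Fp_inj _ _ _ _ pr pE).
Qed.

Lemma prod_neg_squares p N : prime p -> p = (2 * N + 1)%N ->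
  \prod_(k < N) - (k.+1%:R ^+ 2) = -1 :> 'F_p.
Proof.
move=> pr pE.
have N0 : (0 < N)%N by have := prime_gt1 pr; lia.
have -> : -1 = ('X^N - 1 : {poly 'F_p}).[0].
  have z : 0 ^+ N = 0 :> 'F_p by rewrite -(prednK N0) exprS mul0r.
  by rewrite !hornerE z sub0r.
rewrite -(prod_XsubC_squares _ _ pr pE) horner_prod.
by apply: eq_bigr => k _; rewrite hornerXsubC sub0r.
Qed.

(* The numerator is, up to sign, the derivative of
   [\prod_k (X - k^2) = X^N - 1] at [j^2]. *)
Lemma prod_square_ratio p N (j : 'I_N) : prime p -> p = (2 * N + 1)%N ->
  \prod_(k < N | k != j)
    ((k.+1%:R ^+ 2 - j.+1%:R ^+ 2) / k.+1%:R ^+ 2) = - 2^-1 :> 'F_p.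
Proof.
move=> pr pE.
have N0 : (0 < N)%N by have := prime_gt1 pr; lia.
have nz (k : 'I_N) : k.+1%:R != 0 :> 'F_p.
  by apply: natr_Fp_neq0 => //; have := ltn_ord k; lia.
have two0 : 2 != 0 :> 'F_p by apply: (natr_Fp_neq0 p 2) => //; lia.
have NE : N%:R = - 2^-1 :> 'F_p.
  apply: (mulfI two0); rewrite mulrN divff //; apply/eqP.
  by rewrite -subr_eq0 opprK -natrM natr1 natr_Fp_eq0 // -addn1 -pE dvdnn.
have A := prod_neg_squares _ _ pr pE.
rewrite (bigD1 j) //= in A.
(* The derivative [N X^(N-1)] at [a = (j + 1)^2] is [N / a], since [a^N = 1]. *)
have B : \prod_(k < N | k != j) (j.+1%:R ^+ 2 - k.+1%:R ^+ 2)
         = N%:R * (j.+1%:R ^+ 2)^-1 :> 'F_p.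
  have /(congr1 (fun q => q^`().[j.+1%:R ^+ 2])) := prod_XsubC_squares _ _ pr pE.
  rewrite (bigD1 j) //= derivM derivXsubC mul1r hornerD hornerM hornerXsubC.
  rewrite subrr mul0r addr0 horner_prod derivB derivXn -polyC1 derivC subr0.
  under eq_bigr do rewrite hornerXsubC.
  rewrite hornerMn hornerXn => ->.
  have j2 : j.+1%:R ^+ 2 != 0 :> 'F_p by rewrite expf_neq0.
  rewrite -[LHS]mulr_natl; congr (_ * _); apply: (mulIf j2).
  rewrite mulVf // -exprSr prednK // -exprM (_ : (2 * N)%N = p.-1).
    by rewrite Fp_expf_pred.
  by rewrite pE addn1.
have -> : \prod_(k < N | k != j)
    ((k.+1%:R ^+ 2 - j.+1%:R ^+ 2) / k.+1%:R ^+ 2) =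
  \prod_(k < N | k != j) (j.+1%:R ^+ 2 - k.+1%:R ^+ 2) /
  \prod_(k < N | k != j) - (k.+1%:R ^+ 2) :> 'F_p.
  rewrite -prodf_div; apply: eq_bigr => k _.
  by rewrite invrN mulrN -mulNr opprB.
rewrite B NE; move: A; set P := \prod_(_ < _ | _) _ => A.
have P0 : P != 0.
  by apply/prodf_neq0 => k _; rewrite oppr_eq0 expf_neq0.
have -> : P = (j.+1%:R ^+ 2)^-1.
  have n2 : - (j.+1%:R ^+ 2) != 0 :> 'F_p by rewrite oppr_eq0 expf_neq0.
  apply: (mulfI n2); rewrite A mulNr divff // expf_neq0 //.
by rewrite mulfK // invr_eq0 expf_neq0.
Qed.

(** * Euler polynomials and alternating power sums *)

(* [2 ^ n E_n((x + 1) / 2)] in terms of the usual Euler polynomials [E_n]; the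
   generating function is [2 exp(x t) / (exp t + exp(- t))]. *)
Definition euler_poly (F : comNzRingType) (e : nat -> F) (n : nat) (x : F) : F :=
  \sum_(k < n.+1) 'C(n, k)%:R * e k * x ^+ (n - k).

Definition euler_recurrence (F : comNzRingType) (e : nat -> F) : Prop :=
  forall n, \sum_(k < n.+1) 'C(n, k)%:R * e k * (1 + (-1) ^+ (n - k)) =
            2 *+ (n == 0%N).

(** Padding with zero binomials gives the double sum in [euler_poly_rec] a rectangular range, so
    that its sums can be exchanged. *)
Lemma exprDn_widen (F : comNzRingType) (x y : F) (m n : nat) : (m <= n)%N ->
  (x + y) ^+ m = \sum_(i < n.+1) 'C(m, i)%:R * x ^+ (m - i) * y ^+ i.
Proof.
move=> mn; rewrite exprDn.
rewrite (big_ord_widen n.+1 (fun i => x ^+ (m - i) * y ^+ i *+ 'C(m, i))) //.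
rewrite big_mkcond; apply: eq_bigr => i _.
rewrite -mulr_natl mulrA; case: ifP => // /negbT.
by rewrite -leqNgt => mi; rewrite bin_small // !mul0r.
Qed.

Lemma bin_trinomial (n k i : nat) : (k <= n)%N -> (i <= n)%N ->
  ('C(n, k) * 'C(n - k, i) = 'C(n, i) * 'C(n - i, k))%N.
Proof.
move=> kn inn; have [ki|ki] := leqP (k + i) n; last first.
  by rewrite !(bin_small (n := _ - _)) ?muln0 //; lia.
have f1 := bin_fact kn; have f2 := bin_fact inn.
have f3 : ('C(n - k, i) * (i`! * (n - k - i)`!) = (n - k)`!)%N.
  by apply: bin_fact; lia.
have f4 : ('C(n - i, k) * (k`! * (n - i - k)`!) = (n - i)`!)%N.
  by apply: bin_fact; lia.
have sE : (n - i - k = n - k - i)%N by lia.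
rewrite sE in f4.
have pos : (0 < k`! * i`! * (n - k - i)`!)%N by rewrite !muln_gt0 !fact_gt0.
apply/eqP; rewrite -(eqn_pmul2r pos); apply/eqP.
transitivity n`!.
  by rewrite -f1 -f3; ring.
by rewrite -f2 -f4; ring.
Qed.

(** After both binomials are expanded and the sums exchanged, the coefficient of [x^i] contains the
    recurrence at [n - i], which is zero unless [i = n]. *)
Lemma euler_poly_rec (F : comNzRingType) (e : nat -> F) n x :
  euler_recurrence F e ->
  euler_poly F e n (x + 1) + euler_poly F e n (x - 1) = 2 * x ^+ n.
Proof.
move=> he; rewrite /euler_poly -big_split /=.
transitivity (\sum_(k < n.+1) \sum_(i < n.+1)
   ('C(n, i)%:R * x ^+ i)
     * ('C(n - i, k)%:R * e k * (1 + (-1) ^+ (n - i - k)))).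
  apply: eq_bigr => k _.
  have kn : (k <= n)%N by rewrite -ltnS.
  rewrite ![x + _]addrC !(exprDn_widen _ _ _ (n - k) n) ?leq_subr //.
  rewrite -mulrDr -big_split /= mulr_sumr; apply: eq_bigr => i _.
  have inn : (i <= n)%N by rewrite -ltnS.
  have := bin_trinomial n k i kn inn => /(congr1 (fun z => z%:R : F)).
  rewrite !natrM => H; rewrite expr1n mulr1 subnAC.
  transitivity ('C(n, k)%:R * 'C(n - k, i)%:R * e k * x ^+ i
                * (1 + (-1) ^+ (n - i - k))); first by ring.
  by rewrite H; ring.
rewrite exchange_big /= (bigD1 ord_max) //= [X in _ + X]big1 ?addr0 => [|i].
  rewrite -mulr_sumr subnn big_ord_recl big1 => [|j _]; last first.
    by rewrite /bump /= bin_small // !mul0r.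
  have := he 0%N; rewrite big_ord1 /= => ->.
  by rewrite binn mul1r addr0 mulrC.
move=> ni; have {ni} ni : (i < n)%N.
  by have := ltn_ord i; rewrite ltnS leq_eqVlt (negPf ni : (i : nat) == n = false).
rewrite -mulr_sumr; have := he (n - i)%N.
rewrite (_ : (n - i == 0)%N = false); last by lia.
rewrite mulr0n (big_ord_widen n.+1 (fun k => 'C(n - i, k)%:R * e k
  * (1 + (-1) ^+ (n - i - k)))); last by rewrite ltnS leq_subr.
rewrite big_mkcond /= => H; rewrite [X in _ * X](_ : _ = 0) ?mulr0 // -[RHS]H.
apply: eq_bigr => k _; case: ifP => // /negbT; rewrite -leqNgt => ki.
by rewrite bin_small // !mul0r.
Qed.

(** The sum telescopes by [euler_poly_rec] at the points [x + 1 + 2i]. *)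
Lemma euler_alternating_sum (F : comNzRingType) (e : nat -> F) n x M :
  euler_recurrence F e ->
  2 * \sum_(i < M) (-1) ^+ i * (x + 1 + (2 * i)%:R) ^+ n =
  euler_poly F e n x - (-1) ^+ M * euler_poly F e n (x + (2 * M)%:R).
Proof.
move=> he; elim: M => [|M IH].
  by rewrite big_ord0 mulr0 expr0 muln0 addr0 mul1r subrr.
rewrite big_ord_recr /= mulrDr IH mulrCA.
have := euler_poly_rec F e n (x + 1 + (2 * M)%:R) he => <-.
have -> : x + 1 + (2 * M)%:R - 1 = x + (2 * M)%:R by ring.
have -> : x + 1 + (2 * M)%:R + 1 = x + (2 * M.+1)%:R.
  by rewrite mulnS natrD; ring.
by rewrite exprS; ring.
Qed.

(** In the recurrence at odd [n], even [k] carry the factor [1 + (-1)^(n-k) = 0] and smaller odd [k]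
    vanish by induction, so only [2 e n] is left. *)
Lemma euler_odd_eq0 (F : fieldType) (e : nat -> F) :
  2 != 0 :> F -> euler_recurrence F e -> forall n, odd n -> e n = 0.
Proof.
move=> two0 he n; have [m] := ubnP n; elim: m n => // m IH n nm on.
have := he n; rewrite (_ : (n == 0)%N = false); last by case: n on {nm}.
rewrite big_ord_recr /= big1 => [|k _].
  rewrite subnn expr0 binn mul1r add0r mulr0n => /eqP.
  by rewrite mulf_eq0 (negPf two0) orbF => /eqP.
have [ok|ok] := boolP (odd k).
  by rewrite IH ?mulr0 ?mul0r //; have := ltn_ord k; lia.
rewrite -signr_odd oddB ?on ?(negPf ok) ?expr1 ?subrr ?mulr0 //.
by rewrite ltnW.
Qed.

(** Only even [k] contribute, and there [2 (-1)^(n-k) = 1 + (-1)^(n-k)]: twice the value is the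
    recurrence sum. *)
Lemma euler_polyN1_eq0 (F : fieldType) (e : nat -> F) n :
  2 != 0 :> F -> euler_recurrence F e -> ~~ odd n -> (0 < n)%N ->
  euler_poly F e n (-1) = 0.
Proof.
move=> two0 he en n0; apply: (mulfI two0); rewrite mulr0 /euler_poly mulr_sumr.
have := he n; rewrite gtn_eqF // mulr0n => H; rewrite -[RHS]H; apply: eq_bigr => k _.
have kn : (k <= n)%N by rewrite -ltnS.
have [ok|ok] := boolP (odd k).
  by rewrite (euler_odd_eq0 F e two0 he k ok) mulr0 !mul0r mulr0.
rewrite -signr_odd oddB // (negPf en) (negPf ok) expr0; ring.
Qed.

Lemma euler_poly0 (F : comNzRingType) (e : nat -> F) n : euler_poly F e n 0 = e n.
Proof.
rewrite /euler_poly big_ord_recr big1 /= => [|k _].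
  by rewrite subnn binn add0r mulr1 mul1r.
have : (0 < n - k)%N by rewrite subn_gt0.
by case: (n - k)%N => // m _; rewrite exprS mul0r mulr0.
Qed.

(** This is [euler_alternating_sum] with exponent [p - 3] from 0 to [2N = -1], where the polynomial
    vanishes; Fermat turns [a^(p-3)] into [a^-2]. *)
Lemma euler_sum_odd_powers p N (e : nat -> 'F_p) :
  prime p -> p = (2 * N + 1)%N -> (1 < N)%N -> euler_recurrence 'F_p e ->
  2 * \sum_(i < N) (-1) ^+ i / (2 * i + 1)%:R ^+ 2 = e (p - 3)%N.
Proof.
move=> pr pE N1 he.
have two0 : 2 != 0 :> 'F_p by apply: (natr_Fp_neq0 p 2) => //; lia.
have := euler_alternating_sum 'F_p e (p - 3) 0 N he.
have -> : 0 + (2 * N)%:R = -1 :> 'F_p.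
  apply/eqP; rewrite add0r -subr_eq0 opprK natr1 natr_Fp_eq0 //.
  by rewrite -addn1 -pE dvdnn.
rewrite euler_polyN1_eq0 //; try by lia.
rewrite mulr0 subr0 euler_poly0 => <-; congr (_ * _).
apply: eq_bigr => i _; congr (_ * _).
have -> : 0 + 1 + (2 * i)%:R = (2 * i + 1)%:R :> 'F_p by rewrite natrD; ring.
set a := _%:R.
have a0 : a != 0.
  by apply: natr_Fp_neq0 => //; have := ltn_ord i; lia.
apply: (mulIf (expf_neq0 2 a0)); rewrite mulVf ?expf_neq0 // -exprD.
by rewrite -(Fp_expf_pred p a) //; congr (_ ^+ _); lia.
Qed.

(** * Quadratic residues and half-range sums *)

(** An injection from [N] indices into [[1, N]] is a bijection. The shift [k.+1] reconciles that
    range with ordinals starting at 0. *)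
Lemma reindex_ordS (R : Type) (idx : R) (op : Monoid.com_law idx) (N : nat)
    (f : nat -> nat) (G : nat -> R) :
  (forall k, (k < N)%N -> (0 < f k <= N)%N) ->
  (forall k l, (k < N)%N -> (l < N)%N -> f k = f l -> k = l) ->
  \big[op/idx]_(k < N) G (f k) = \big[op/idx]_(k < N) G k.+1.
Proof.
move=> f_bd f_inj; pose h (k : 'I_N) := insubd k (f k).-1.
have hE k : (h k).+1 = f k.
  have := f_bd k (ltn_ord k) => /andP[f0 fN].
  by rewrite /h val_insubd (_ : (f k).-1 < N)%N ?prednK //; lia.
have h_inj : injective h.
  move=> k l kl; apply/val_inj/f_inj; rewrite ?ltn_ord //.
  by rewrite -!hE kl.
rewrite [RHS](reindex_inj h_inj) /=.
by apply: eq_bigr => k _; rewrite hE.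
Qed.

(* The representative in [1, (p-1)/2] of [+- 2(k+1)] modulo p. *)
Definition gauss_rep (p k : nat) : nat :=
  if (4 * k.+1 < p)%N then (2 * k.+1)%N else (p - 2 * k.+1)%N.

Lemma gauss_rep_bound p N k : p = (2 * N + 1)%N -> (k < N)%N ->
  (0 < gauss_rep p k <= N)%N.
Proof. by move=> pE kN; rewrite /gauss_rep; case: ifP; lia. Qed.

Lemma gauss_rep_inj p N k l : p = (2 * N + 1)%N -> (k < N)%N -> (l < N)%N ->
  gauss_rep p k = gauss_rep p l -> k = l.
Proof. by move=> pE kN lN; rewrite /gauss_rep; case: ifP; case: ifP; lia. Qed.

Lemma gauss_rep_Fp p N k : prime p -> p = (2 * N + 1)%N -> (k < N)%N ->
  2 * k.+1%:R = (-1) ^+ (p < 4 * k.+1)%N * (gauss_rep p k)%:R :> 'F_p.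
Proof.
move=> pr pE kN; rewrite /gauss_rep.
have [lt4|le4] := ltnP (4 * k.+1) p.
  by rewrite ltnNge ltnW // expr0 mul1r natrM.
have -> : (p < 4 * k.+1)%N by lia.
rewrite natrB ?natrM ?pchar_Fp_0 //; last by lia.
by rewrite expr1 mulN1r sub0r opprK.
Qed.

(** The exponent counts the [k] in [[1, M]] with [4k > c]; truncated subtraction covers
    [4M <= c]. *)
Lemma prod_sign_ge (R : comNzRingType) (c M : nat) :
  \prod_(k < M) (-1) ^+ (c < 4 * k.+1)%N = (-1) ^+ (M - c %/ 4) :> R.
Proof.
elim: M => [|M IH]; first by rewrite big_ord0 sub0n expr0.
rewrite big_ord_recr /= IH -exprD; congr (_ ^+ _).
by case: ltnP; lia.
Qed.

(** Gauss's lemma for 2: doubling permutes [1, ..., N] up to sign, so [2^N N!] is [N!] times the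
    product of the signs. *)
Lemma two_expf_half p N : prime p -> p = (2 * N + 1)%N ->
  2 ^+ N = (-1) ^+ (N + N %/ 2) :> 'F_p.
Proof.
move=> pr pE.
pose P : 'F_p := \prod_(k < N) k.+1%:R.
have P0 : P != 0.
  apply/prodf_neq0 => k _; apply: natr_Fp_neq0 => //.
  by have := ltn_ord k; lia.
apply: (mulIf P0); rewrite -{1}(card_ord N) -prodr_const -big_split /=.
under eq_bigr => k _ do rewrite (gauss_rep_Fp _ _ _ pr pE (ltn_ord k)).
rewrite big_split /= prod_sign_ge.
rewrite (reindex_ordS _ _ _ N (gauss_rep p) (fun k => k%:R)) -/P.
(* Here [p %/ 4 = N %/ 2], and [N - N %/ 2] has the parity of [N + N %/ 2]. *)
- congr (_ * _); rewrite -signr_odd -[RHS]signr_odd; congr (_ ^+ _); lia.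
- by move=> k; apply: gauss_rep_bound.
- by move=> k l; apply: gauss_rep_inj.
Qed.

(** Euler's criterion: a nonzero square has [N]-th power 1 by Fermat, and conversely a root of
    [X^N - 1] is one of the squares in [prod_XsubC_squares]. *)
Lemma legendre_Fp p N (a : int) e : prime p -> p = (2 * N + 1)%N ->
  a%:~R ^+ N = (-1) ^+ e :> 'F_p -> legendre a p = (-1) ^+ e.
Proof.
move=> pr pE aN.
have N0 : (0 < N)%N by have := prime_gt1 pr; lia.
have N1 : -1 != 1 :> 'F_p.
  rewrite -subr_eq0 -opprD oppr_eq0 -mulr2n.
  by apply: (natr_Fp_neq0 p 2) => //; lia.
rewrite /legendre -intr_Fp_eq0 //.
have [a0|a0] := eqVneq (a%:~R : 'F_p) 0.
  have : (-1) ^+ e != 0 :> 'F_p by rewrite expf_neq0 // oppr_eq0 oner_neq0.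
  by rewrite -aN a0 -(prednK N0) exprS mul0r eqxx.
have modE (x : nat) : (x%:Z ^+ 2 == a %[mod p%:Z])%Z = (x%:R ^+ 2 == a%:~R :> 'F_p).
  rewrite eqz_mod_dvd -intr_Fp_eq0 // rmorphB rmorphXn /= subr_eq0.
  by rewrite pmulrn.
case: existsP => [[x]|nex].
  rewrite modE => /eqP xa; have x0 : x%:R != 0 :> 'F_p.
    by apply: contra a0 => /eqP x0; rewrite -xa x0 expr0n.
  move: aN; rewrite -xa -exprM (_ : (2 * N)%N = p.-1); last by rewrite pE addn1.
  rewrite Fp_expf_pred // => /esym/eqP; rewrite -signr_odd -[RHS]signr_odd.
  by case: odd => //; rewrite expr1 (negPf N1).
rewrite -[RHS]signr_odd; case oe: (odd e) => //.
case: nex; have := congr1 (horner^~ (a%:~R)) (prod_XsubC_squares _ _ pr pE).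
rewrite horner_prod hornerD hornerN hornerXn hornerC aN -signr_odd oe expr0 subrr.
move/eqP/prodf_eq0 => [k _]; rewrite hornerXsubC subr_eq0 => /eqP ak.
have kp : (k.+1 < p)%N by have := ltn_ord k; lia.
by exists (Ordinal kp); rewrite modE /= ak.
Qed.

Lemma legendre_2 p N : prime p -> p = (2 * N + 1)%N ->
  legendre 2 p = (-1) ^+ (N + N %/ 2).
Proof. by move=> pr pE; apply: (legendre_Fp _ _ _ _ pr pE); apply: two_expf_half. Qed.

Lemma legendre_N2 p N : prime p -> p = (2 * N + 1)%N ->
  legendre (- 2) p = (-1) ^+ (N %/ 2).
Proof.
move=> pr pE; apply: (legendre_Fp _ _ _ _ pr pE).
have -> : (- 2)%:~R = - 2 :> 'F_p by rewrite rmorphN.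
rewrite -mulN1r exprMn (two_expf_half _ _ pr pE) exprD mulrA -expr2.
by rewrite sqrr_sign mul1r.
Qed.

(** Doubling permutes [1, ..., N] up to sign, so [S = S / 4], and 3 is invertible. *)
Lemma sum_inv_squares p N : prime p -> (3 < p)%N -> p = (2 * N + 1)%N ->
  \sum_(k < N) k.+1%:R ^- 2 = 0 :> 'F_p.
Proof.
move=> pr p3 pE; set S := \sum_(_ < _) _.
have SE : S = 2 ^- 2 * S.
  rewrite /S -(reindex_ordS _ _ _ N (gauss_rep p) (fun k => k%:R ^- 2)).
  - rewrite [in RHS](reindex_ordS _ _ _ N (gauss_rep p) (fun k => k%:R ^- 2)).
    + rewrite mulr_sumr; apply: eq_bigr => k _.
      rewrite -invfM -exprMn (gauss_rep_Fp _ _ _ pr pE) // exprMn.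
      by rewrite sqrr_sign mul1r.
    + by move=> k; apply: gauss_rep_bound.
    + by move=> k l; apply: gauss_rep_inj.
  - by move=> k; apply: gauss_rep_bound.
  - by move=> k l; apply: gauss_rep_inj.
have n3 : 3 != 0 :> 'F_p by apply: (natr_Fp_neq0 p 3) => //; lia.
have n2 : 2 != 0 :> 'F_p by apply: (natr_Fp_neq0 p 2) => //; lia.
apply: (mulfI n3); rewrite mulr0.
have -> : 3 * S = 4 * S - S by ring.
by rewrite {1}SE mulrA -[4]/((2 * 2)%N%:R) natrM -expr2 divff ?expf_neq0 // mul1r subrr.
Qed.

Lemma odd_Fp p N l : prime p -> p = (2 * N + 1)%N -> (l < N)%N ->
  (2 * l + 1)%:R = - (2 * (N - l)%:R) :> 'F_p.
Proof.
move=> pr pE lN; apply/eqP; rewrite -subr_eq0 opprK -natrM -natrD natr_Fp_eq0 //.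
by rewrite (_ : 2 * l + 1 + _ = p)%N ?dvdnn //; lia.
Qed.

Lemma sum_inv_odd_squares p N : prime p -> (3 < p)%N -> p = (2 * N + 1)%N ->
  \sum_(l < N) (2 * l + 1)%:R ^- 2 = 0 :> 'F_p.
Proof.
move=> pr p3 pE.
transitivity (2 ^- 2 * \sum_(k < N) k.+1%:R ^- 2 : 'F_p); last first.
  by rewrite (sum_inv_squares _ _ pr p3 pE) mulr0.
rewrite mulr_sumr (reindex_inj rev_ord_inj) /=; apply: eq_bigr => k _.
rewrite (odd_Fp _ _ _ pr pE); last by have := ltn_ord k; lia.
rewrite sqrrN exprMn invfM (_ : N - _ = k.+1)%N //.
by have := ltn_ord k; lia.
Qed.

(** Since [2l + 1 = - 2 (N - l)] modulo [p], the reflection [l -> N - l] gives the inverse of the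
    product in [prod_square_ratio]. *)
Lemma prod_odd_square_ratio p N (m : 'I_N) : prime p -> p = (2 * N + 1)%N ->
  \prod_(l < N | l != m)
    ((2 * l + 1)%:R ^+ 2 / ((2 * l + 1)%:R ^+ 2 - (2 * m + 1)%:R ^+ 2)) = - 2 :> 'F_p.
Proof.
move=> pr pE.
have n2 : 2 != 0 :> 'F_p.
  by apply: (natr_Fp_neq0 p 2) => //; have := ltn_ord m; lia.
have := prod_square_ratio p N (rev_ord m) pr pE => /(congr1 GRing.inv).
rewrite invrN invrK -prodfV => <-.
rewrite (reindex_inj rev_ord_inj) /=; apply: eq_big => [l|l _].
  by rewrite (can2_eq rev_ordK rev_ordK).
have hl : (N - (N - l.+1) = l.+1)%N by have := ltn_ord l; lia.
have hm : (N - m = (N - m.+1).+1)%N by have := ltn_ord m; lia.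
rewrite !(odd_Fp _ _ _ pr pE) ?ltn_ord //; last by have := ltn_ord l; lia.
rewrite hl hm !sqrrN !exprMn -mulrBr invfM mulrACA divff ?mul1r ?expf_neq0 //.
by rewrite invf_div.
Qed.

(** * The terms of the expansion modulo p^4 *)

(* The [k] in [1, N] with [4k = +- (2m+1)] modulo [p = 2N+1]: the index of the
   only factor of [\prod_k (16 k^2 - (2m+1)^2)] divisible by p. *)
Definition quarter_rep (N m : nat) : nat :=
  if odd (N - m) then ((N + m + 1) %/ 2)%N else ((N - m) %/ 2)%N.

Lemma quarter_rep_bound N m : (m < N)%N -> (0 < quarter_rep N m <= N)%N.
Proof. by move=> mN; rewrite /quarter_rep; case: ifP; lia. Qed.

Lemma quarter_rep_inj N m l : (m < N)%N -> (l < N)%N ->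
  quarter_rep N m = quarter_rep N l -> m = l.
Proof. by move=> mN lN; rewrite /quarter_rep; case: ifP; case: ifP; lia. Qed.

Lemma quarter_repE (R : comNzRingType) N m : (m < N)%N ->
  4 * (quarter_rep N m)%:R =
  (2 * N + 1)%:R - (-1) ^+ (N - m) * (2 * m + 1)%:R :> R.
Proof.
move=> mN; rewrite /quarter_rep -signr_odd; case: ifP => o.
  rewrite expr1 mulN1r opprK -natrD -natrM; congr (_%:R); lia.
rewrite expr0 mul1r -natrB; last lia.
by rewrite -natrM; congr (_%:R); lia.
Qed.

(** Makes the sign of a term depend on [m] only through [k = quarter_rep N m], which yields an
    alternating sum over [k]. *)
Lemma quarter_rep_sign (R : comNzRingType) N m : (m < N)%N ->
  (-1) ^+ (m %/ 2) * (-1) ^+ (N - m) =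
  (-1) ^+ (N %/ 2) * (-1) ^+ quarter_rep N m :> R.
Proof.
move=> mN; rewrite -!exprD -signr_odd -[RHS]signr_odd; congr (_ ^+ _).
by rewrite /quarter_rep; case: ifP; lia.
Qed.

(** Put [a = 2m + 1], [s = (-1)^(N-m)] and [k = quarter_rep N m]. As [4k = p - s a], the factor at
    [k] has numerator [p (p - 2 s a)]; modulo [p] the other factors multiply to [-1/2], by
    [prod_square_ratio]. *)
Lemma even_square_ratio_reduces p N (m : nat) : prime p -> p = (2 * N + 1)%N ->
  (m < N)%N ->
  exists delta, reduces p delta
      ((-1) ^+ (N - m) * (2 * m + 1)%:R / (16 * (quarter_rep N m)%:R ^+ 2)) /\
    \prod_(i < N) ((16 * i.+1%:R ^+ 2 - (2 * m + 1)%:R ^+ 2)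
                   / (16 * i.+1%:R ^+ 2)) = p%:R * delta.
Proof.
move=> pr pE mN.
have /andP[k0 kN] := quarter_rep_bound N m mN.
have n2 : 2 != 0 :> 'F_p by apply: (natr_Fp_neq0 _ 2 pr); lia.
have n16 : 16 != 0 :> 'F_p by rewrite -[16]/((2 ^ 4)%N%:R) natrX expf_neq0.
set s := (-1) ^+ _; set a := (2 * m + 1)%N; set k := quarter_rep N m in k0 kN *.
have jN : (k.-1 < N)%N by lia.
pose j := Ordinal jN; have jE : (j : nat).+1 = k by rewrite prednK.
have nz (i : 'I_N) : i.+1%:R != 0 :> 'F_p.
  by apply: natr_Fp_neq0 => //; have := ltn_ord i; lia.
have kE (R : comNzRingType) : 4 * k%:R = p%:R - (-1) ^+ (N - m) * a%:R :> R.
  by rewrite pE; apply: quarter_repE.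
have aE : a%:R ^+ 2 = 16 * k%:R ^+ 2 :> 'F_p.
  have -> : 16 * k%:R ^+ 2 = (4 * k%:R) ^+ 2 :> 'F_p by ring.
  by rewrite kE pchar_Fp_0 // sub0r sqrrN exprMn sqrr_sign mul1r.
pose rest : rat := \prod_(i < N | i != j)
   ((16 * i.+1%:R ^+ 2 - a%:R ^+ 2) / (16 * i.+1%:R ^+ 2)).
exists ((p%:R - 2 * (-1) ^+ (N - m) * a%:R) / (16 * k%:R ^+ 2) * rest); split.
  have nk0 : k%:R != 0 :> 'F_p by rewrite -jE.
  have nk : 16 * k%:R ^+ 2 != 0 :> 'F_p by rewrite mulf_neq0 // expf_neq0.
  have -> : s * a%:R / (16 * k%:R ^+ 2) =
     (p%:R - 2 * (-1) ^+ (N - m) * a%:R) / (16 * k%:R ^+ 2) * (- 2^-1) :> 'F_p.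
    rewrite pchar_Fp_0 // sub0r -/s; field.
    by rewrite n2 nk0 n16.
  apply: reducesM.
    apply: reducesM; last first.
      apply: reducesV => //; apply: reducesM; first exact: (reduces_nat p 16).
      exact/reducesX/reduces_nat.
    apply: reducesB; first exact: reduces_nat.
    apply: reducesM; last exact: reduces_nat.
    apply: reducesM; first exact: (reduces_nat p 2).
    exact/reducesX/(reduces_int p (-1)).
  rewrite -(prod_square_ratio p N j pr pE).
  apply: reduces_prod => i _.
  have ni : 16 * i.+1%:R ^+ 2 != 0 :> 'F_p by rewrite mulf_neq0 // expf_neq0.
  have -> : (i.+1%:R ^+ 2 - j.+1%:R ^+ 2) / i.+1%:R ^+ 2 =
     (16 * i.+1%:R ^+ 2 - a%:R ^+ 2) / (16 * i.+1%:R ^+ 2) :> 'F_p.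
    rewrite aE jE; move: (nz i); move: (i.+1%:R : 'F_p) => z z0.
    by field; rewrite z0 n16.
  have h16 : reduces p (16 * i.+1%:R ^+ 2) (16 * i.+1%:R ^+ 2).
    apply: reducesM; first exact: (reduces_nat p 16).
    exact/reducesX/reduces_nat.
  apply: reducesM; last exact: reducesV.
  by apply: reducesB => //; apply/reducesX/reduces_nat.
rewrite (bigD1 j) //= -/rest jE [RHS]mulrA; congr (_ * _).
rewrite [RHS]mulrA; congr (_ / _).
have -> : 16 * k%:R ^+ 2 = (4 * k%:R) ^+ 2 :> rat by ring.
rewrite kE; have : (-1) ^+ (N - m) ^+ 2 = 1 :> rat by exact: sqrr_sign.
move: (_ ^+ (N - m)) => t t2.
have -> : (p%:R - t * a%:R) ^+ 2 - a%:R ^+ 2 =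
  p%:R * (p%:R - 2 * t * a%:R) + (t ^+ 2 - 1) * a%:R ^+ 2 by ring.
by rewrite t2 subrr mul0r addr0.
Qed.

(** One factor [p] comes from the even squares and [p^2] from the node [p^2]. What remains is
    reduced with the product over the other nodes equal to [-2] and [p^2 - a^2] to [- a^2], where
    [a = 2m + 1]. *)
Lemma lagrange_term_reduces p N (m : 'I_N) : prime p -> p = (2 * N + 1)%N ->
  exists tau, reduces p tau
      ((-1) ^+ (N %/ 2) * ((-1) ^+ quarter_rep N m / (8 * (quarter_rep N m)%:R ^+ 2))) /\
    (-1) ^+ (m %/ 2) * (2 * m + 1)%:R
    * \prod_(i < N) ((16 * i.+1%:R ^+ 2 - (2 * m + 1)%:R ^+ 2) / (16 * i.+1%:R ^+ 2))
    * (\prod_(l < N | l != m)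
        ((2 * l + 1)%:R ^+ 2 / ((2 * l + 1)%:R ^+ 2 - (2 * m + 1)%:R ^+ 2))
       * (p%:R ^+ 2 / (p%:R ^+ 2 - (2 * m + 1)%:R ^+ 2)))
    = p%:R ^+ 3 * tau.
Proof.
move=> pr pE.
have [delta [hdelta ->]] := even_square_ratio_reduces p N m pr pE (ltn_ord m).
set Q := \prod_(_ < _ | _) _; set a := (2 * m + 1)%N.
have mN := ltn_ord m.
have /andP[k0 kN] := quarter_rep_bound N m mN.
exists ((-1) ^+ (m %/ 2) * a%:R * delta * (Q / (p%:R ^+ 2 - a%:R ^+ 2))); split; last first.
  by ring.
have na : a%:R != 0 :> 'F_p by apply: natr_Fp_neq0 => //; lia.
have n2 : 2 != 0 :> 'F_p by apply: (natr_Fp_neq0 _ 2 pr); lia.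
have nk : (quarter_rep N m)%:R != 0 :> 'F_p by apply: natr_Fp_neq0 => //; lia.
have hpa : p%:R ^+ 2 - a%:R ^+ 2 != 0 :> 'F_p.
  by rewrite pchar_Fp_0 // expr0n sub0r oppr_eq0 expf_neq0.
rewrite mulrA -quarter_rep_sign //.
have -> : (-1) ^+ (m %/ 2) * (-1) ^+ (N - m) / (8 * (quarter_rep N m)%:R ^+ 2) =
  (-1) ^+ (m %/ 2) * a%:R *
    ((-1) ^+ (N - m) * a%:R / (16 * (quarter_rep N m)%:R ^+ 2)) *
    (- 2 / (p%:R ^+ 2 - a%:R ^+ 2)) :> 'F_p.
  rewrite pchar_Fp_0 // expr0n sub0r.
  have n8 : 8 != 0 :> 'F_p by rewrite -[8]/((2 ^ 3)%N%:R) natrX expf_neq0.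
  have n16 : 16 != 0 :> 'F_p by rewrite -[16]/((2 ^ 4)%N%:R) natrX expf_neq0.
  by field; rewrite oppr_eq0 expf_neq0 // nk n16 n8.
apply: reducesM.
  apply: reducesM => //; apply: reducesM; last exact: reduces_nat.
  exact/reducesX/(reduces_int p (-1)).
apply: reducesM; last first.
  apply: reducesV => //.
  by apply: reducesB; apply/reducesX/reduces_nat.
rewrite -(prod_odd_square_ratio p N m pr pE); apply: reduces_prod => l lm.
have hd : reduces p ((2 * l + 1)%:R ^+ 2 - a%:R ^+ 2) ((2 * l + 1)%:R ^+ 2 - a%:R ^+ 2).
  by apply: reducesB; apply/reducesX/reduces_nat.
apply: reducesM; first exact/reducesX/reduces_nat.
apply: reducesV => //.
(* Distinct odd squares below [p^2] stay distinct modulo [p], by reflection to [sqr_natr_Fp_inj]. *)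
rewrite /a !(odd_Fp _ _ _ pr pE) // !sqrrN !exprMn -mulrBr mulf_neq0 ?expf_neq0 //.
have lN := ltn_ord l; have : val l != val m by [].
have [r rE] : exists r, (N - l = r.+1)%N by exists (N - l).-1; lia.
have [t tE] : exists t, (N - m = t.+1)%N by exists (N - m).-1; lia.
have rN : (r < N)%N by lia.
have tN : (t < N)%N by lia.
rewrite rE tE subr_eq0; apply: contra => /eqP.
move/(sqr_natr_Fp_inj p N (Ordinal rN) (Ordinal tN) pr pE)/(congr1 val) => /= rt.
by apply/eqP; lia.
Qed.

(** Cross terms carry [p^4], so modulo [p] the coefficients of [p^2] simply add. *)
Lemma prod_one_plus_sqr p (I : Type) (s : seq I) (P : pred I) (u : I -> rat) r :
  prime p ->
  (forall i, P i -> reduces p (u i) (r i)) ->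
  exists v, reduces p v (\sum_(i <- s | P i) r i) /\
    \prod_(i <- s | P i) (1 + p%:R ^+ 2 * u i) = 1 + p%:R ^+ 2 * v.
Proof.
move=> pr h.
apply: (big_ind2 (fun x t => exists v, reduces p v t /\ x = 1 + p%:R ^+ 2 * v)).
- by exists 0; split; [exact: (reduces_nat p 0) | rewrite mulr0 addr0].
- move=> x1 t1 x2 t2 [v1 [h1 ->]] [v2 [h2 ->]].
  exists (v1 + v2 + p%:R ^+ 2 * (v1 * v2)); split; last by ring.
  have -> : t1 + t2 = t1 + t2 + 0 ^+ 2 * (t1 * t2) by rewrite expr0n mul0r addr0.
  rewrite -(pchar_Fp_0 pr).
  apply: reducesD; first exact: reducesD.
  by apply: reducesM; [apply/reducesX/reduces_nat | apply: reducesM].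
- by move=> i /h hi; exists (u i).
Qed.

(** This is the node [p^2]. Each product is [1 + p^2 v] with [v] reducing to a multiple of a sum of
    inverse squares; both sums vanish modulo [p], which supplies the third factor [p]. *)
Lemma last_lagrange_ratio p N : prime p -> (3 < p)%N -> p = (2 * N + 1)%N ->
  exists w r, reduces p w r /\
    \prod_(i < N) ((16 * i.+1%:R ^+ 2 - p%:R ^+ 2) / (16 * i.+1%:R ^+ 2))
    * \prod_(l < N) ((2 * l + 1)%:R ^+ 2 / ((2 * l + 1)%:R ^+ 2 - p%:R ^+ 2))
    = 1 + p%:R ^+ 3 * w :> rat.
Proof.
move=> pr p3 pE.
have n2 : 2 != 0 :> 'F_p by apply: (natr_Fp_neq0 _ 2 pr); lia.
have n16 : 16 != 0 :> 'F_p by rewrite -[16]/((2 ^ 4)%N%:R) natrX expf_neq0.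
have nz (i : 'I_N) : i.+1%:R != 0 :> 'F_p.
  by apply: natr_Fp_neq0 => //; have := ltn_ord i; lia.
have hu (i : 'I_N) : reduces p (- (16 * i.+1%:R ^+ 2)^-1) (- (16 * i.+1%:R ^+ 2)^-1).
  apply/reducesN/reducesV; first by rewrite mulf_neq0 // expf_neq0.
  apply: reducesM; first exact: (reduces_nat p 16).
  exact/reducesX/reduces_nat.
have nb (l : 'I_N) : (2 * l + 1)%:R ^+ 2 - p%:R ^+ 2 != 0 :> 'F_p.
  rewrite pchar_Fp_0 // expr0n subr0 expf_neq0 //.
  by apply: natr_Fp_neq0 => //; have := ltn_ord l; lia.
have hb (l : 'I_N) : reduces p ((2 * l + 1)%:R ^+ 2 - p%:R ^+ 2)
                               ((2 * l + 1)%:R ^+ 2 - p%:R ^+ 2).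
  by apply: reducesB; apply/reducesX/reduces_nat.
have [v1 [h1 E1]] := prod_one_plus_sqr p 'I_N (index_enum _) xpredT _ _ pr
  (fun i _ => hu i).
have [v2 [h2 E2]] := prod_one_plus_sqr p 'I_N (index_enum _) xpredT _ _ pr
  (fun l _ => reducesV _ _ _ (nb l) (hb l)).
have s1 : \sum_(i < N) - (16 * i.+1%:R ^+ 2)^-1 = 0 :> 'F_p.
  under eq_bigr do rewrite invfM -mulrN mulrN -mulNr.
  by rewrite -mulr_sumr (sum_inv_squares _ _ pr p3 pE) mulr0.
have s2 : \sum_(l < N) ((2 * l + 1)%:R ^+ 2 - p%:R ^+ 2)^-1 = 0 :> 'F_p.
  under eq_bigr do rewrite pchar_Fp_0 // expr0n subr0.
  exact: sum_inv_odd_squares.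
rewrite s1 in h1; rewrite s2 in h2.
have [w1 [t1 [hw1 w1E]]] := reduces0 p v1 pr h1.
have [w2 [t2 [hw2 w2E]]] := reduces0 p v2 pr h2.
exists (w1 + w2 + p%:R ^+ 3 * (w1 * w2)), (t1 + t2 + p%:R ^+ 3 * (t1 * t2)); split.
  apply: reducesD; first exact: reducesD.
  by apply: reducesM; [apply/reducesX/reduces_nat | apply: reducesM].
transitivity ((1 + p%:R ^+ 2 * v1) * (1 + p%:R ^+ 2 * v2)); last first.
  by rewrite w1E w2E; ring.
rewrite -E1 -E2; congr (_ * _); apply: eq_bigr => i _.
  field; rewrite addrC natr1 pnatr_eq0 //.
have : (2 * i + 1)%:R ^+ 2 - p%:R ^+ 2 != 0 :> rat.
  have [c [d [d0 -> cE]]] := hb i.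
  have := nb i; rewrite cE; apply: contra.
  rewrite mulf_eq0 invr_eq0 (negPf (intr_Fp_rat _ _ d0)) orbF intr_eq0 => /eqP ->.
  by rewrite mul0r.
by rewrite natrD natrM => H; field.
Qed.

(** * Residues of the Euler numbers and assembly of the congruence *)

Lemma reduces_uniq p x r s : reduces p x r -> reduces p x s -> r = s.
Proof.
move=> [a [b [b0 xE ->]]] [c [d [d0]]]; rewrite xE => /eqP.
rewrite eqr_div ?(intr_Fp_rat _ _ b0) ?(intr_Fp_rat _ _ d0) //.
rewrite -!rmorphM eqr_int => /eqP H ->.
by apply/eqP; rewrite eqr_div // -!rmorphM H.
Qed.

Lemma reduces_numden p x r : prime p -> reduces p x r ->
  reduces p x ((numq x)%:~R / (denq x)%:~R).
Proof.
move=> pr hx; have := reduces_prime_to_denom p x r pr hx.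
rewrite inE /coprimez => cop.
exists (numq x), (denq x); split=> //; last by rewrite divq_num_den.
rewrite intr_Fp_eq0 //; apply/negP => dv.
have : (p %| `|denq x|)%N by exact: dv.
rewrite -[(p %| _)%N]negbK -prime_coprime // coprime_sym.
by move/negP; apply; move: cop.
Qed.

(** Solving the recurrence for [E n] divides only by 2, so every [E n] has a residue; uniqueness of
    residues carries the recurrence over to ['F_p]. *)
Lemma euler_numbers_reduce (R : realType) (E : nat -> rat) p :
  is_euler_numbers R E -> prime p -> 2 != 0 :> 'F_p ->
  exists2 e : nat -> 'F_p, euler_recurrence 'F_p e & forall n, reduces p (E n) (e n).
Proof.
move=> hE pr n2; have recE := euler_numbers_recurrence R E hE.
pose e n : 'F_p := (numq (E n))%:~R / (denq (E n))%:~R.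
have hsign k : reduces p ((-1) ^+ k) ((-1) ^+ k).
  exact/reducesX/(reduces_int p (-1)).
have he n : reduces p (E n) (e n).
  suff [r hr] : exists r, reduces p (E n) r by apply: reduces_numden hr.
  have [m] := ubnP n; elim: m n => // m IH n nm.
  have IH' (k : 'I_n) : reduces p (E k) (e k).
    have [r hr] : exists r, reduces p (E k) r.
      by apply: IH; have := ltn_ord k; lia.
    exact: reduces_numden hr.
  have := recE n; rewrite big_ord_recr /= subnn expr0 binn mul1r => H.
  have -> : E n = (2 *+ (n == 0%N) -
    \sum_(k < n) 'C(n, k)%:R * E k * (1 + (-1) ^+ (n - k))) / 2.
    by rewrite -H; field.
  exists ((2 *+ (n == 0%N) -
    \sum_(k < n) 'C(n, k)%:R * e k * (1 + (-1) ^+ (n - k))) / 2).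
  apply: reducesM; last by apply: reducesV => //; exact: (reduces_nat p 2).
  apply: reducesB.
    by case: eqP => _; [exact: (reduces_nat p 2) | exact: (reduces_nat p 0)].
  apply: reduces_sum => k _; apply: reducesM.
    by apply: reducesM => //; exact: reduces_nat.
  by apply: reducesD => //; exact: (reduces_nat p 1).
exists e => // n; apply: (@reduces_uniq p (2 *+ (n == 0%N))); last first.
  by case: eqP => _; [exact: (reduces_nat p 2) | exact: (reduces_nat p 0)].
rewrite -recE; apply: reduces_sum => k _; apply: reducesM.
  by apply: reducesM => //; exact: reduces_nat.
by apply: reducesD => //; exact: (reduces_nat p 1).
Qed.

(** As [quarter_rep N] permutes [[1, N]], the sum runs over [k]. Then [k = N - i] and
    [2i + 1 = - 2k] lead to [euler_sum_odd_powers]. *)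
Lemma sum_quarter_rep p N (e : nat -> 'F_p) :
  prime p -> p = (2 * N + 1)%N -> (1 < N)%N -> euler_recurrence 'F_p e ->
  \sum_(m < N) (-1) ^+ (N %/ 2) *
     ((-1) ^+ quarter_rep N m / (8 * (quarter_rep N m)%:R ^+ 2)) =
  (-1) ^+ (N + N %/ 2) * e (p - 3)%N / 4.
Proof.
move=> pr pE N1 he.
have n2 : 2 != 0 :> 'F_p by apply: (natr_Fp_neq0 _ 2 pr); lia.
rewrite (reindex_ordS _ _ _ N (quarter_rep N)
  (fun k => (-1) ^+ (N %/ 2) * ((-1) ^+ k / (8 * k%:R ^+ 2)))); last first.
- by move=> k l; apply: quarter_rep_inj.
- by move=> k; apply: quarter_rep_bound.
rewrite -(euler_sum_odd_powers p N e pr pE N1 he) mulr_sumr mulr_sumr mulr_suml.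
rewrite (reindex_inj rev_ord_inj) /=; apply: eq_bigr => i _.
have iN := ltn_ord i.
rewrite (odd_Fp _ _ _ pr pE) // (_ : (N - i.+1).+1 = N - i)%N; last by lia.
have n8 : 8 != 0 :> 'F_p by rewrite -[8]/((2 ^ 3)%N%:R) natrX expf_neq0.
have n4 : 4 != 0 :> 'F_p by rewrite -[4]/((2 ^ 2)%N%:R) natrX expf_neq0.
have nk : (N - i)%:R != 0 :> 'F_p by apply: natr_Fp_neq0 => //; lia.
have sg : (-1) ^+ (N - i) = (-1) ^+ N * (-1) ^+ i :> 'F_p.
  by rewrite -exprD -signr_odd -[RHS]signr_odd; congr (_ ^+ _); lia.
by rewrite sg exprD; field; rewrite n4 oppr_eq0 mulf_neq0 // nk n8.
Qed.

Lemma truncated_sum_padic p N : prime p -> (3 < p)%N -> p = (2 * N + 1)%N ->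
  exists w T s, [/\ reduces p w s,
   reduces p T (\sum_(m < N) (-1) ^+ (N %/ 2) *
     ((-1) ^+ quarter_rep N m / (8 * (quarter_rep N m)%:R ^+ 2)))
   & \sum_(0 <= n < N.+1) (6 * n + 1)%:R / (- 512) ^+ n * 'C(2 * n, n)%:R ^+ 3 =
     (-1) ^+ (N %/ 2) * p%:R * (1 + p%:R ^+ 3 * w) + p%:R ^+ 3 * T].
Proof.
move=> pr p3 pE.
have [w [s [hw wE]]] := last_lagrange_ratio p N pr p3 pE.
have [tau htau] := boolp.choice (fun m : 'I_N => lagrange_term_reduces p N m pr pE).
exists w, (\sum_m tau m), s; split=> //.
  by apply: reduces_sum => m _; have [] := htau m.
(* The term [m = N], where [2m + 1 = p], is the main term; the others have the factor [l = N] split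
   off. *)
rewrite truncated_sum_expansion big_ord_recr /= addrC; congr (_ + _).
  rewrite -wE -pE -!mulrA; congr (_ * (_ * (_ * _))).
  rewrite big_mkcond big_ord_recr /= eqxx mulr1; apply: eq_bigr => l _.
  by rewrite -val_eqE /= ltn_eqF.
rewrite mulr_sumr; apply: eq_bigr => m _; have [_ <-] := htau m.
congr (_ * _); rewrite big_mkcond big_ord_recr /=; congr (_ * _).
  by rewrite [RHS]big_mkcond; apply: eq_bigr => l _; rewrite -!val_eqE.
by rewrite -val_eqE /= gtn_eqF // -pE.
Qed.

Theorem theorem1p1 (R : realType) (E : nat -> rat)
    (hE : is_euler_numbers R E)
    (p : nat) (p_prime : prime p) (p_gt3 : (3 < p)%N) :
  eq_mod_loc p (p%:R ^+ 4)
    (\sum_(0 <= n < ((p - 1) %/ 2).+1)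
        (6 * n + 1)%:R / (- 512) ^+ n * 'C(2 * n, n)%:R ^+ 3)
    (p%:R * (legendre (- 2) p)%:~R
      + p%:R ^+ 3 / 4 * (legendre 2 p)%:~R * E (p - 3)%N).
Proof.
have p_odd : odd p by case: (even_prime p_prime) p_gt3 => [->|].
set N := ((p - 1) %/ 2)%N.
have pE : p = (2 * N + 1)%N by rewrite /N; lia.
have two0 : 2 != 0 :> 'F_p by apply: (natr_Fp_neq0 p 2); lia.
have four0 : 4 != 0 :> 'F_p by rewrite -[4]/((2 ^ 2)%N%:R) natrX expf_neq0.
have [e he redE] := euler_numbers_reduce R E p hE p_prime two0.
have [w [T [s [hw hT ->]]]] := truncated_sum_padic p N p_prime p_gt3 pE.
rewrite (sum_quarter_rep p N e p_prime pE) // in hT; last by lia.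
rewrite (legendre_2 p N) // (legendre_N2 p N) // !rmorphXn !rmorphN !rmorph1.
have hs k : reduces p ((-1) ^+ k) ((-1) ^+ k).
  exact/reducesX/(reduces_int p (-1)).
have hp k : reduces p (p%:R ^+ k) (p%:R ^+ k) by exact/reducesX/reduces_nat.
have h4 : reduces p 4^-1 4^-1 by apply: reducesV => //; exact: (reduces_nat p 4).
have hD : reduces p (T - (-1) ^+ (N + N %/ 2) * E (p - 3)%N / 4) 0.
  rewrite -(subrr ((-1) ^+ (N + N %/ 2) * e (p - 3)%N / 4)).
  apply: reducesB => //; apply: reducesM => //; exact: reducesM.
have [z [t [hz zE]]] := reduces0 p _ p_prime hD.
split.
- apply: (@reduces_prime_to_denom p _ ((-1) ^+ (N %/ 2) * p%:R * (1 + p%:R ^+ 3 * s)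
     + p%:R ^+ 3 * ((-1) ^+ (N + N %/ 2) * e (p - 3)%N / 4))) => //.
  apply: reducesD; last exact: reducesM.
  apply: reducesM; first by apply: reducesM => //; exact: reduces_nat.
  by apply: reducesD; [exact: (reduces_nat p 1) | exact: reducesM].
- apply: (@reduces_prime_to_denom p _ (p%:R * (-1) ^+ (N %/ 2)
     + p%:R ^+ 3 / 4 * (-1) ^+ (N + N %/ 2) * e (p - 3)%N)) => //.
  apply: reducesD; first by apply: reducesM => //; exact: reduces_nat.
  by apply: reducesM => //; apply: reducesM => //; exact: reducesM.
(* The main term leaves [p p^3 w] up to sign, and [p^3 T] differs from the Euler term by
   [p^3 (p z)]. *)
exists ((-1) ^+ (N %/ 2) * w + z).
  apply: (@reduces_prime_to_denom p _ ((-1) ^+ (N %/ 2) * s + t)) => //.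
  by apply: reducesD => //; exact: reducesM.
have -> : T = p%:R * z + (-1) ^+ (N + N %/ 2) * E (p - 3)%N / 4.
  by rewrite -zE subrK.
by field.
Qed.
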